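(* For every $\Gamma>0$, the function $(\boldsymbol{x}_1,\boldsymbol{x}_2)\mapsto \mathrm{IEM}(\boldsymbol{x}_1,\boldsymbol{x}_2,\Gamma)$ is a distance metric on $\mathbb{R}^d$. That is, for all $\boldsymbol{x}_1,\boldsymbol{x}_2,\boldsymbol{x}_3\in\mathbb{R}^d$: (i) $\mathrm{IEM}(\boldsymbol{x}_1,\boldsymbol{x}_2,\Gamma)=\mathrm{IEM}(\boldsymbol{x}_2,\boldsymbol{x}_1,\Gamma)$; (ii) $\mathrm{IEM}(\boldsymbol{x}_1,\boldsymbol{x}_2,\Gamma)\ge 0$; (iii) $\mathrm{IEM}(\boldsymbol{x}_1,\boldsymbol{x}_2,\Gamma)=0$ if and only if $\boldsymbol{x}_1=\boldsymbol{x}_2$; (iv) $\mathrm{IEM}(\boldsymbol{x}_1,\boldsymbol{x}_3,\Gamma)\le \mathrm{IEM}(\boldsymbol{x}_1,\boldsymbol{x}_2,\Gamma)+\mathrm{IEM}(\boldsymbol{x}_2,\boldsymbol{x}_3,\Gamma)$.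
   Context: Let $\mathbf{x}$ be a random vector in $\mathbb{R}^d$ with probability density $p_{\mathbf{x}}$. For $\gamma\ge 0$ define the Gaussian channel $\mathbf{y}_\gamma=\gamma\mathbf{x}+\mathbf{w}_\gamma$, where $(\mathbf{w}_\gamma)_{\gamma\ge0}$ is a standard Wiener process in $\mathbb{R}^d$ (so $\mathbf{w}_\gamma\sim\mathcal N(\mathbf{0},\gamma \boldsymbol I)$) independent of $\mathbf{x}$. For $\gamma>0$, $p_{\mathbf{y}_\gamma}$ denotes the (smooth, strictly positive) density of $\mathbf{y}_\gamma$, i.e. the density of $\gamma\mathbf{x}$ convolved with the $\mathcal N(\mathbf 0,\gamma \boldsymbol I)$ density, and $\nabla\log p_{\mathbf{y}_\gamma}$ is its score (gradient of its logarithm). The Information-Estimation Metric is $$\mathrm{IEM}(\boldsymbol{x}_1,\boldsymbol{x}_2,\Gamma)=\Big(\int_0^{\Gamma}\mathbb{E}\big[\|\nabla\log p_{\mathbf{y}_\gamma}(\gamma\boldsymbol{x}_1+\mathbf{w}_\gamma)-\nabla\log p_{\mathbf{y}_\gamma}(\gamma\boldsymbol{x}_2+\mathbf{w}_\gamma)\|^2\big]\,d\gamma\Big)^{1/2},$$ where for each $\gamma$ the expectation is over $\mathbf{w}_\gamma\sim\mathcal N(\mathbf 0,\gamma\boldsymbol I)$. It is assumed that this integral is finite for all $\boldsymbol{x}_1,\boldsymbol{x}_2$. *)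

(* Defs.v *)
From HB Require Import structures.
From mathcomp Require Import all_boot all_order all_algebra.
From mathcomp Require Import all_classical all_reals all_analysis.
Set Implicit Arguments. Unset Strict Implicit. Unset Printing Implicit Defensive.
Import Order.TTheory GRing.Theory Num.Theory.
Import numFieldNormedType.Exports.
Local Open Scope classical_set_scope.
Local Open Scope ring_scope.

(* Integral over R^d w.r.t. d-dimensional Lebesgue measure, written as the
   iterated (one coordinate at a time) Lebesgue integral.  It is only ever
   applied to non-negative functions, for which it coincides (Tonelli) with
   the integral against the d-dimensional Lebesgue measure. *)
Fixpoint rint {R : realType} (d : nat) : ('rV[R]_d -> \bar R) -> \bar R :=
  match d return ('rV[R]_d -> \bar R) -> \bar R with
  | 0 => fun f => f 0
  | d'.+1 => fun f =>
      (\int[@lebesgue_measure R]_(t in [set: R])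
         rint (fun v : 'rV[R]_d' => f (row_mx (\row_(_ < 1) t) v)))%E
  end.

Definition borel_rV {R : realType} (d : nat) : set (set 'rV[R]_d) :=
  <<s [set U : set 'rV[R]_d | open U] >>.

Definition is_density {R : realType} (d : nat) (p : 'rV[R]_d -> R) : Prop :=
  (forall x, 0 <= p x) /\
  (forall B : set R, measurable B -> borel_rV (p @^-1` B)) /\
  rint (fun x => (p x)%:E) = 1%E.

Definition sqnorm {R : realType} (d : nat) (v : 'rV[R]_d) : R :=
  \sum_(i < d) v 0 i ^+ 2.

Definition gauss_pdf {R : realType} (d : nat) (g : R) (z : 'rV[R]_d) : R :=
  (2 * pi * g) `^ (- (d%:R / 2)) * expR (- (sqnorm z) / (2 * g)).

(* density of y_g = g x + w_g, w_g ~ N(0, g I) independent of x ~ px *)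
Definition py {R : realType} (d : nat) (px : 'rV[R]_d -> R) (g : R)
  (y : 'rV[R]_d) : R :=
  fine (rint (fun x => (px x * gauss_pdf g (y - g *: x))%:E)).

Definition score {R : realType} (d : nat) (px : 'rV[R]_d -> R) (g : R)
  (y : 'rV[R]_d) : 'rV[R]_d :=
  \row_(i < d) 'D_(delta_mx 0 i) (fun z => ln (py px g z)) y.

Definition iem_integrand {R : realType} (d : nat) (px : 'rV[R]_d -> R)
  (x1 x2 : 'rV[R]_d) (g : R) : \bar R :=
  rint (fun w => (gauss_pdf g w *
     sqnorm (score px g (g *: x1 + w) - score px g (g *: x2 + w)))%:E).

(* int_0^Gamma E[...] d gamma  (the point gamma = 0 is Lebesgue-null) *)
Definition iem_sq {R : realType} (d : nat) (px : 'rV[R]_d -> R)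
  (x1 x2 : 'rV[R]_d) (G : R) : \bar R :=
  \int[@lebesgue_measure R]_(g in `]0, G]%classic) (iem_integrand px x1 x2 g).

Definition IEM {R : realType} (d : nat) (px : 'rV[R]_d -> R)
  (x1 x2 : 'rV[R]_d) (G : R) : R :=
  Num.sqrt (fine (iem_sq px x1 x2 G)).

(* Main.v *)
Require Import Defs.
From HB Require Import structures.
From mathcomp Require Import all_boot all_order all_algebra.
From mathcomp Require Import all_classical all_reals all_analysis.
From mathcomp Require Import measurable_realfun lebesgue_integral_under.
From mathcomp Require Import ring lra.
Import Order.TTheory GRing.Theory Num.Theory.
Import numFieldNormedType.Exports.
Local Open Scope classical_set_scope.
Local Open Scope ring_scope.

(* Write [p_g] for the density of [y_g].  The triangle inequality is the one of
   an L^2 norm.  If IEM vanishes at [(x1, x2)], then for some [g > 0] the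
   scores at [g x1 + w] and [g x2 + w] agree for almost every [w], hence for
   every [w] since the score is continuous.  So [ln p_g (y + v) - ln p_g y] does
   not depend on [y], where [v = g (x1 - x2)].  For [v <> 0], iterating the
   shift by [v] or by [- v] keeps [p_g] bounded below by a positive constant,
   whereas [p_g] tends to 0 at infinity by dominated convergence. *)

(** * The measure space behind the iterated integral *)

(** All regularity comes from the Gaussian kernel: it and its partial derivatives are bounded
    uniformly in position, so a constant times [px] dominates every integrand that is differentiated
    or passed to a limit. Calculus is done along coordinate lines throughout. The score is made of
    partial derivatives, and continuity on each such line suffices to go from almost every point to
    every point, one coordinate at a time. The triangle inequality is not taken from a Minkowski
    inequality for the double integral: the bound of [sqnorm (u + v)] by [(1 + a) * sqnorm u + (1 +
    a^-1) * sqnorm v] is linear in the squares, hence survives both integrations, and [a] is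
    optimised only afterwards. The optimum requires positive integrals, so separation of points is
    established before the triangle inequality. *)

(* The iterated integral [rint] is the integral against one sigma-finite
   measure on a product type; this makes Fubini and the convergence theorems
   available.  The third clause is the only trace kept of the fact that
   Lebesgue measure charges open sets. *)
Definition is_model {R : realType} {d : nat} {disp} {T : measurableType disp}
    (mu : {sigma_finite_measure set T -> \bar R}) (phi : T -> 'rV[R]_d) : Prop :=
  [/\ forall f : 'rV[R]_d -> \bar R, (forall x, 0 <= f x)%E ->
        measurable_fun [set: T] (fun t => f (phi t)) ->
        rint f = (\int[mu]_t f (phi t))%E,
      forall i, measurable_fun [set: T] (fun t => phi t 0 i) &
      forall f : 'rV[R]_d -> R, (forall x, 0 <= f x) ->
        (forall x i, continuous (fun s : R => f (x + s *: delta_mx 0 i))) ->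
        measurable_fun [set: T] (fun t => f (phi t)) ->
        (\int[mu]_t (f (phi t))%:E = 0)%E -> forall x, f x = 0].

(** Otherwise the exceptional null set would contain an interval of length [b - a > 0]. *)
Lemma ae_in_itv {R : realType} (P : R -> Prop) (a b : R) :
  {ae @lebesgue_measure R, forall t, P t} -> a < b ->
  exists2 t, a < t < b & P t.
Proof.
move=> [N [mN N0 PN]] ab; apply: contrapT => nP.
have sub : `]a, b[%classic `<=` N.
  move=> t /=; rewrite in_itv/= => tab; apply: PN => /= Pt.
  by apply: nP; exists t.
have : (lebesgue_measure `]a, b[%classic <= lebesgue_measure N)%E.
  by apply: le_measure => //; rewrite inE.
rewrite N0 lebesgue_measure_itv/= lte_fin ab -EFinB lee_fin.
by rewrite leNgt subr_gt0 ab.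
Qed.

Lemma ge0_integral_eq0_ae {R : realType} d (T : measurableType d)
    (mu : {measure set T -> \bar R}) (D : set T) (f : T -> \bar R) :
  measurable D -> measurable_fun D f -> (forall t, D t -> 0 <= f t)%E ->
  (\int[mu]_(t in D) f t = 0)%E -> {ae mu, forall t, D t -> f t = 0%E}.
Proof.
move=> mD mf f0 intf; apply/(ae_eq_integral_abs _ mD mf).
rewrite -[RHS]intf; apply: eq_integral => t /set_mem Dt.
by rewrite gee0_abs// f0.
Qed.

(** With the next lemma, this sorts the coordinate lines of dimension [1 + d] into lines of the tail
    and moves of the head, so that continuity on lines passes through an induction on the
    dimension. *)
Lemma row_mx_add_rshift {R : realType} (d : nat) (t s : R) (v : 'rV[R]_d) i :
  row_mx (\row_(_ < 1) t) v + s *: delta_mx 0 (rshift 1 i) =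
  row_mx (\row_(_ < 1) t) (v + s *: delta_mx 0 i) :> 'rV[R]_(1 + d).
Proof.
apply/rowP => j; rewrite !mxE; case: splitP => k jk; rewrite ?mxE.
  rewrite (_ : j == _ = false) ?andbF ?mulr0 ?addr0//.
  by apply/eqP => /(congr1 val)/=; rewrite jk; case: k jk => -[].
by congr (_ + _ * (_ && _)%:R); rewrite -!val_eqE/= jk eqn_add2l.
Qed.

Lemma row_mx_add_lshift {R : realType} (d : nat) (t s : R) (v : 'rV[R]_d) :
  row_mx (\row_(_ < 1) t) v + s *: delta_mx 0 (lshift d ord0) =
  row_mx (\row_(_ < 1) (t + s)) v :> 'rV[R]_(1 + d).
Proof.
apply/rowP => j; rewrite !mxE; case: splitP => k jk; rewrite ?mxE -!val_eqE/= jk.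
  by rewrite ord1 mulr1.
by rewrite mulr0 addr0.
Qed.

Lemma row_mx_hd_tl {R : realType} (d : nat) (x : 'rV[R]_(1 + d)) :
  x = row_mx (\row_(_ < 1) x 0 (lshift d ord0)) (rsubmx x).
Proof.
rewrite -[LHS]hsubmxK; congr row_mx.
by apply/rowP => j; rewrite !mxE (ord1 j).
Qed.

(** Increasing exhaustions of the two factors are needed so that a single index [i + j] captures
    both coordinates of a point. *)
Lemma sigma_finite_product {R : realType} d1 d2 (T1 : measurableType d1)
    (T2 : measurableType d2) (m1 : {sigma_finite_measure set T1 -> \bar R})
    (m2 : {sigma_finite_measure set T2 -> \bar R}) :
  sigma_finite [set: (T1 * T2)%type] (m1 \x m2)%E.
Proof.
have [F [TF incF Ffin]] := (sigma_finiteP _ _).1 (sigma_finiteT m1).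
have [G [TG incG Gfin]] := (sigma_finiteP _ _).1 (sigma_finiteT m2).
exists (fun n => F n `*` G n) => [|n].
  apply/seteqP; split=> // -[x y] _.
  have [i _ Fx] : (\bigcup_i F i) x by rewrite -TF.
  have [j _ Gy] : (\bigcup_j G j) y by rewrite -TG.
  exists (i + j)%N => //; split => /=.
  - exact: (subsetPset _ _ (incF _ _ (leq_addr j i))).
  - exact: (subsetPset _ _ (incG _ _ (leq_addl i j))).
have [[mF Foo] [mG Goo]] := (Ffin n, Gfin n).
split; first exact: measurableX.
by rewrite product_measure1E// lte_mul_pinfty// ge0_fin_numE.
Qed.

(** Induction on [d]: a Dirac mass in dimension 0, where [rint] is evaluation at the only vector,
    then the product with Lebesgue measure, where Tonelli matches the recursion of [rint]. For the
    third clause, the slice of [f] above almost every head [t] integrates to 0, hence vanishes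
    identically by induction. *)
Lemma model_exists {R : realType} (d : nat) :
  exists disp (T : measurableType disp)
    (mu : {sigma_finite_measure set T -> \bar R}) (phi : T -> 'rV[R]_d),
    is_model mu phi.
Proof.
elim: d => [|d [disp [T [mu [phi [IHint IHm IHae]]]]]].
  exists _, unit, (@dirac _ unit tt R), (fun=> 0); split.
  - move=> f f0 mf /=; rewrite integral_dirac// diracT mul1e; congr f.
  - by move=> [].
  - move=> f f0 cf mf; rewrite integral_dirac// diracT mul1e => -[f00] x.
    by rewrite -f00; congr f; apply/rowP => -[].
pose leb : {sigma_finite_measure set (measurableTypeR R) -> \bar R} :=
  @lebesgue_measure R.
pose mu' : {sigma_finite_measure set (measurableTypeR R * T)%type -> \bar R} :=
  HB.pack (leb \x mu)%E (Measure_isSigmaFinite.Build _ _ _ (leb \x mu)%E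
    (sigma_finite_product _ _ _ _ leb mu)).
pose phi' (p : measurableTypeR R * T) : 'rV[R]_d.+1 :=
  row_mx (\row_(_ < 1) p.1) (phi p.2) : 'rV[R]_(1 + d).
exists _, _, mu', phi'; split.
- move=> f f0 mf /=.
  rewrite (fubini_tonelli1 (fun p => f (phi' p)))//=.
  apply: eq_integral => t _; rewrite /fubini_F IHint//.
  exact: (measurable_fun_pair2 (f := fun p => f (phi' p))).
- move=> i; rewrite /phi'.
  under eq_fun do rewrite mxE.
  case: splitP => k ik.
    by under eq_fun do rewrite mxE; exact: measurable_fst.
  exact: measurableT_comp (IHm k) measurable_snd.
- move=> f f0 cf mf intf x.
  pose F t := (\int[mu]_v (f (phi' (t, v)))%:E)%E.
  have mEf : measurable_fun setT (fun p => (f (phi' p))%:E).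
    exact/measurable_EFinP.
  have F0 : {ae @lebesgue_measure R, forall t, F t = 0%E}.
    have mF : measurable_fun setT F.
      by apply: (measurable_fun_fubini_tonelli_F _ mEf) => p; rewrite lee_fin.
    have F_ge0 t : (0 <= F t)%E by apply: integral_ge0 => v _; rewrite lee_fin.
    have intF : (\int[@lebesgue_measure R]_t F t = 0)%E.
      rewrite -[RHS]intf (fubini_tonelli1 (fun p => (f (phi' p))%:E))//.
      by move=> p; rewrite lee_fin.
    have F_ae := ge0_integral_eq0_ae _ _ _ _ _ measurableT mF (fun t _ => F_ge0 t) intF.
    by apply: filterS F_ae => t; exact.
  have f0ae : {ae @lebesgue_measure R, forall t,
      forall v, f (row_mx (\row_(_ < 1) t) v : 'rV[R]_(1 + d)) = 0}.
    apply: filterS F0 => t Ft; apply: IHae => //.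
      move=> y i; have := cf (row_mx (\row_(_ < 1) t) y : 'rV[R]_(1 + d)) (rshift 1 i).
      by under eq_fun do rewrite row_mx_add_rshift.
    exact: (measurable_fun_pair2 (f := fun p => f (phi' p))).
  rewrite (row_mx_hd_tl d x); set t0 := x _ _; set v := rsubmx _.
  apply/eqP/negPn/negP => fx0.
  have fxgt0 : 0 < f (row_mx (\row_(_ < 1) t0) v : 'rV[R]_(1 + d)).
    by rewrite lt_neqAle eq_sym fx0 f0.
  (* Continuity in the head coordinate keeps [f] positive for heads within [e] of [t0], yet this
     interval contains a head whose whole slice vanishes. *)
  have := cf (row_mx (\row_(_ < 1) t0) v : 'rV[R]_(1 + d)) (lshift d (ord0 : 'I_1)) 0.
  under eq_fun do rewrite row_mx_add_lshift.
  rewrite /continuous_at addr0 => /cvgrPdist_lt /(_ _ fxgt0) [e /= e0 He].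
  have [|t /andP[t1 t2] ft] := @ae_in_itv R _ (t0 - e) (t0 + e) f0ae.
    by lra.
  have te : `|0 - (t - t0)| < e by rewrite sub0r normrN ltr_norml; lra.
  by have := He _ te; rewrite /= addrCA subrr addr0 ft subr0 gtr0_norm// ltxx.
Qed.

(** * Measurability *)

Section measurability.
Context {R : realType} {d : nat} {disp} {S : measurableType disp}.
Implicit Types (Y : S -> 'rV[R]_d) (g : S -> R).

Definition measurable_coords Y :=
  forall i, measurable_fun [set: S] (fun s => Y s 0 i).

(** Balls of row vectors are boxes, that is, finite intersections of conditions on single
    coordinates. *)
Lemma measurable_preimage_ball Y (q : 'rV[R]_d) (e : R) :
  measurable_coords Y -> 0 < e -> measurable (Y @^-1` ball q e).
Proof.
move=> mY e0.
rewrite (_ : _ @^-1` _ =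
    \bigcap_(j in [set: 'I_d]) [set s | `|q 0 j - Y s 0 j| < e]).
  apply: fin_bigcap_measurable => // j _.
  have mq : measurable_fun [set: S] (fun s => `|q 0 j - Y s 0 j|).
    by apply: measurableT_comp => //; apply: measurable_funB.
  have := mq measurableT _ (measurable_itv `]-oo, e[); rewrite setTI.
  congr measurable; apply/seteqP; split => s /=; by rewrite in_itv.
apply/seteqP; split => s /=.
  by move=> [_ qY] j _; exact: qY.
by move=> qY; split => // i j; rewrite ord1; exact: qY.
Qed.

(** An open set is the countable union of the balls with rational centre and radius [n.+1%:R^-1]
    that it contains. *)
Lemma measurable_preimage_open Y (U : set 'rV[R]_d) :
  measurable_coords Y -> open U -> measurable (Y @^-1` U).
Proof.
move=> mY oU.
pose F (p : 'rV[rat]_d * nat) : set S :=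
  let B := ball (map_mx (@ratr R) p.1) (p.2.+1%:R^-1 : R) in
  if `[< B `<=` U >] then Y @^-1` B else set0.
rewrite (_ : _ @^-1` _ = \bigcup_p F p).
  apply: countable_bigcupT_measurable; first exact: countableP.
  move=> p; rewrite /F; case: ifP => // _.
  by apply: measurable_preimage_ball => //; rewrite invr_gt0.
apply/seteqP; split => s /=; last first.
  by move=> [p _]; rewrite /F; case: ifPn => // /asboolP BU /BU.
move=> UYs.
have /nbhs_ballP[e /= e0 eU] : nbhs (Y s) U by exact: open_nbhs_nbhs.
(* Half of [e]: the rational ball contains [Y s], and its points are within two radii of [Y s]. *)
have [n ne] : exists n, n.+1%:R^-1 < e / 2.
  have e2 : 0 < e / 2 by rewrite divr_gt0.
  have [n _ /(_ n (leqnn n)) ne] := near_infty_natSinv_lt (PosNum e2).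
  by exists n.
have n0 : 0 < n.+1%:R^-1 :> R by rewrite invr_gt0.
have qP j : exists q : rat, `|ratr q - Y s 0 j| < n.+1%:R^-1.
  have : Y s 0 j - n.+1%:R^-1 < Y s 0 j + n.+1%:R^-1.
    by move: n0; set r := n.+1%:R^-1 => r0; lra.
  move=> /rat_in_itvoo[q]; rewrite in_itv/= => /andP[q1 q2].
  by exists q; rewrite ltr_norml; apply/andP; split; [rewrite ltrBrDr addrC|rewrite ltrBlDl].
have /choice[q qY] := qP.
exists (\row_j q j, n) => //; rewrite /F/=; case: ifPn => [_|/asboolPn].
  by split => // i j; rewrite !mxE ord1; exact: qY.
case => z [_ qz]; apply: eU; split => // i j; rewrite (ord1 i).
have := qz 0 j; have := qY j; rewrite !mxE /ball/= => h1 h2.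
rewrite -(subrKA (ratr (q j))) (le_lt_trans (ler_normD _ _))//.
rewrite (splitr e) ltrD//; first by rewrite distrC (lt_trans h1).
exact: lt_trans h2 ne.
Qed.

(** The sets whose preimage under [Y] is measurable form a sigma-algebra containing the open sets,
    hence all Borel sets. *)
Lemma measurable_borel_comp (p : 'rV[R]_d -> R) Y :
  (forall B : set R, measurable B -> borel_rV (p @^-1` B)) ->
  measurable_coords Y -> measurable_fun [set: S] (fun s => p (Y s)).
Proof.
move=> mp mY _ B mB; rewrite setTI -[X in measurable X]setTI.
have /(_ _ (mp B mB)) : @borel_rV R d `<=` image_set_system setT Y measurable.
  apply: smallest_sub.
    exact/sigma_algebra_image/sigma_algebra_measurable.
  by move=> U oU; rewrite /image_set_system/= setTI; exact: measurable_preimage_open.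
by [].
Qed.

Lemma measurable_funV (f : S -> R) :
  measurable_fun [set: S] f -> measurable_fun [set: S] (fun s => (f s)^-1).
Proof.
move=> mf.
(* [x^-1] is written with powers of the non-negative number [x ^+ 2] *)
rewrite (_ : (fun s => _) = fun s => f s * (f s ^+ 2) `^ (-1)).
  apply: measurable_funM => //.
  by apply: (measurableT_comp (f := fun x : R => x `^ (-1))) => //; exact: measurable_funX.
apply/funext => s; rewrite powR_inv1 ?sqr_ge0//.
have [->|f0] := eqVneq (f s) 0; first by rewrite invr0 mul0r.
by rewrite expr2 invfM mulrA divff// mul1r.
Qed.

Lemma measurable_sqnorm Y :
  measurable_coords Y -> measurable_fun [set: S] (fun s => sqnorm (Y s)).
Proof. by move=> mY; apply: measurable_sum => i; exact: measurable_funX. Qed.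

Lemma measurable_gauss_pdf g Y : measurable_fun [set: S] g ->
  measurable_coords Y -> measurable_fun [set: S] (fun s => gauss_pdf (g s) (Y s)).
Proof.
move=> mg mY; apply: measurable_funM.
  apply: (measurableT_comp (f := fun x : R => x `^ (- (d%:R / 2)))) => //.
  exact: measurable_funM.
apply: measurableT_comp => //; apply: measurable_funM.
  by apply: measurableT_comp => //; exact: measurable_sqnorm.
by apply: measurable_funV; exact: measurable_funM.
Qed.

End measurability.

(** * Gaussian calculus *)

Section gaussian.
Context {R : realType} {d : nat}.
Implicit Types (z : 'rV[R]_d) (i j : 'I_d) (g h : R).

Lemma sqnorm_ge0 z : 0 <= sqnorm z.
Proof. by apply: sumr_ge0 => i _; exact: sqr_ge0. Qed.

Lemma sqr_coord_le_sqnorm z i : z 0 i ^+ 2 <= sqnorm z.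
Proof. by rewrite /sqnorm (bigD1 i)//= lerDl sumr_ge0// => j _; exact: sqr_ge0. Qed.

Lemma sqnorm_line z i h : sqnorm (z + h *: delta_mx 0 i) =
  sqnorm z + (2 * z 0 i * h + h ^+ 2).
Proof.
rewrite /sqnorm (bigD1 i)//= [in RHS](bigD1 i)//= !mxE !eqxx /= mulr1.
rewrite (eq_bigr (fun j => z 0 j ^+ 2)) => [|j ji]; last first.
  by rewrite !mxE (negbTE ji) andbF mulr0 addr0.
ring.
Qed.

Definition gauss_cst g : R := (2 * pi * g) `^ (- (d%:R / 2)).

Lemma gauss_cst_gt0 g : 0 < g -> 0 < gauss_cst g.
Proof. by move=> g0; rewrite powR_gt0// !mulr_gt0// pi_gt0. Qed.

Lemma gauss_pdf_gt0 g z : 0 < g -> 0 < gauss_pdf g z.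
Proof. by move=> g0; rewrite mulr_gt0 ?gauss_cst_gt0// expR_gt0. Qed.

Lemma gauss_pdf_ge0 g z : 0 <= gauss_pdf g z.
Proof. by rewrite mulr_ge0 ?powR_ge0// expR_ge0. Qed.

(** From [1 + u <= expR u], keeping one square of [sqnorm z]. This quadratic decay in one coordinate
    both bounds the partial derivatives and gives the limit at infinity. *)
Lemma gauss_pdf_le g z i : 0 < g ->
  gauss_pdf g z <= gauss_cst g / (1 + z 0 i ^+ 2 / (2 * g)).
Proof.
move=> g0; rewrite ler_wpM2l ?powR_ge0// mulNr expRN lef_pV2 ?posrE ?expR_gt0//.
  rewrite (le_trans (expR_ge1Dx _))// ler_expR ler_pM2r ?invr_gt0 ?mulr_gt0//.
  exact: sqr_coord_le_sqnorm.
by rewrite ltr_pwDl// divr_ge0 ?sqr_ge0// mulr_ge0// ltW.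
Qed.

Lemma gauss_pdf_le_cst g z : 0 < g -> gauss_pdf g z <= gauss_cst g.
Proof.
move=> g0; rewrite ler_piMr ?powR_ge0// -expR0 ler_expR mulNr oppr_le0.
by rewrite divr_ge0 ?sqnorm_ge0// mulr_ge0// ltW.
Qed.

(** The [i]-th partial derivative of [gauss_pdf g] in closed form. *)
Definition dgauss g i z : R := - (z 0 i / g) * gauss_pdf g z.

Definition dgauss_cst g : R := gauss_cst g * (1 + 2 * g) / g.

Lemma dgauss_le g i z : 0 < g -> `|dgauss g i z| <= dgauss_cst g.
Proof.
move=> g0; rewrite normrM normrN normf_div (gtr0_norm g0).
rewrite [X in _ * X]ger0_norm ?gauss_pdf_ge0//.
rewrite /dgauss_cst mulrAC ler_pM2r ?invr_gt0//.
have C0 := gauss_cst_gt0 _ g0; have := gauss_pdf_le g z i g0.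
set u := z 0 i; set C := gauss_cst g in C0 *.
rewrite -(real_normK (num_real u)); set v := `|u|; have v0 : 0 <= v := normr_ge0 u.
move=> Gle; apply: le_trans (ler_wpM2l v0 Gle) _.
have vg : 0 <= v ^+ 2 / (2 * g) by rewrite divr_ge0 ?sqr_ge0// mulr_ge0// ltW.
rewrite mulrCA ler_pM2l// ler_pdivrMr; last by rewrite ltr_pwDl.
(* The factor [1 + 2 * g] of [dgauss_cst] is chosen so that this product contains [1 + v ^+ 2],
   which dominates [v]. *)
have -> : (1 + 2 * g) * (1 + v ^+ 2 / (2 * g)) =
    1 + v ^+ 2 + 2 * g + v ^+ 2 / (2 * g).
  by field; rewrite gt_eqF.
have : v <= 1 + v ^+ 2 by have := sqr_ge0 (v - 1); rewrite sqrrB1; nra.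
lra.
Qed.

Lemma is_derive_gauss_line g i z h : 0 < g ->
  is_derive h (1 : R) (fun s => gauss_pdf g (z + s *: delta_mx 0 i))
    (dgauss g i (z + h *: delta_mx 0 i)).
Proof.
move=> g0.
pose q (s : R) := - (2 * g)^-1 * (sqnorm z + (2 * z 0 i * s + s ^+ 2)).
have qE : (fun s => gauss_pdf g (z + s *: delta_mx 0 i)) =
    gauss_cst g \*: (expR \o q).
  apply/funext => s; rewrite /gauss_pdf sqnorm_line/=; congr (_ * expR _).
  by rewrite /q; ring.
have dq : is_derive h (1 : R) q (- (2 * g)^-1 * (2 * z 0 i + 2 * h)).
  rewrite /q; apply: is_derive_eq; rewrite /GRing.scale/=; ring.
have dE : is_derive h (1 : R) (expR \o q)
    (expR (q h) * (- (2 * g)^-1 * (2 * z 0 i + 2 * h))).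
  exact: is_derive1_comp.
rewrite qE; apply: is_derive_eq (is_deriveZ _ dE) _.
rewrite /dgauss /gauss_pdf sqnorm_line !mxE !eqxx mulr1 /GRing.scale/= -/(gauss_cst g).
rewrite (_ : - _ / (2 * g) = q h); last by rewrite /q; ring.
by field; rewrite gt_eqF.
Qed.

Lemma continuous_gauss_line g i z : 0 < g ->
  continuous (fun s : R => gauss_pdf g (z + s *: delta_mx 0 i)).
Proof.
move=> g0 h; apply/differentiable_continuous/derivable1_diffP.
by have [] := is_derive_gauss_line g i z h g0.
Qed.

Lemma continuous_dgauss_line g i j z : 0 < g ->
  continuous (fun s : R => dgauss g i (z + s *: delta_mx 0 j)).
Proof.
move=> g0 h; rewrite /continuous_at /dgauss.
apply: cvgM; last exact: continuous_gauss_line.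
under eq_fun do rewrite !mxE.
rewrite !mxE; apply: cvgN; apply: cvgM; last exact: cvg_cst.
apply: cvgD; first exact: cvg_cst.
by apply: cvgM; [exact: cvg_id|exact: cvg_cst].
Qed.

End gaussian.

Arguments gauss_cst {R} d g.
Arguments dgauss_cst {R} d g.

(** * Density of the channel output *)

Section channel.
Context {R : realType} {d : nat} {disp} {T : measurableType disp}
  {mu : {sigma_finite_measure set T -> \bar R}} {phi : T -> 'rV[R]_d}
  (phi_model : is_model mu phi) {px : 'rV[R]_d -> R} (px_density : is_density px).
Implicit Types (g : R) (y z : 'rV[R]_d) (i j : 'I_d).

Let rint_model (f : 'rV[R]_d -> \bar R) : (forall x, 0 <= f x)%E ->
  measurable_fun [set: T] (fun t => f (phi t)) -> rint f = (\int[mu]_t f (phi t))%E.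
Proof. by move=> f0 mf; case: phi_model => H _ _; exact: H. Qed.

Let measurable_phi : measurable_coords phi.
Proof. by case: phi_model. Qed.

Let px_ge0 x : 0 <= px x.
Proof. by case: px_density. Qed.

Lemma measurable_density {disp'} {S : measurableType disp'} (Y : S -> 'rV[R]_d) :
  measurable_coords Y -> measurable_fun [set: S] (fun s => px (Y s)).
Proof. by case: px_density => _ [mp _]; exact: measurable_borel_comp. Qed.

Lemma integral_density : (\int[mu]_t (px (phi t))%:E = 1)%E.
Proof.
case: px_density => _ [_ <-]; rewrite rint_model//.
exact/measurable_EFinP/measurable_density.
Qed.

(** Since [px] has integral 1, [C] times it is an integrable majorant. *)
Lemma integrable_density_mul (K : T -> R) (C : R) : measurable_fun [set: T] K ->
  (forall t, `|K t| <= C) ->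
  mu.-integrable [set: T] (EFin \o (fun t => px (phi t) * K t)).
Proof.
move=> mK KC.
have iP : mu.-integrable [set: T] (fun t => C%:E * (px (phi t))%:E)%E.
  apply: integrableZl => //; apply/integrableP; split.
    exact/measurable_EFinP/measurable_density.
  under eq_integral do rewrite gee0_abs ?lee_fin//.
  by rewrite integral_density ltry.
apply: le_integrable iP => //.
  apply/measurable_EFinP; apply: measurable_funM => //.
  exact: measurable_density.
move=> t _ /=; rewrite lee_fin normrM mulrC [leRHS]normrM.
by rewrite ler_wpM2r// (le_trans (KC t))// ler_norm.
Qed.

Definition residual g y t := y - g *: phi t.

Lemma measurable_residual g y : measurable_coords (residual g y).
Proof.
move=> i; under eq_fun do rewrite !mxE.
by apply: measurable_funB => //; exact: measurable_funM.
Qed.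

Lemma measurable_gauss_residual g y :
  measurable_fun [set: T] (fun t => gauss_pdf g (residual g y t)).
Proof. by apply: measurable_gauss_pdf => //; exact: measurable_residual. Qed.

Lemma measurable_dgauss_residual g i y :
  measurable_fun [set: T] (fun t => dgauss g i (residual g y t)).
Proof.
apply: measurable_funM; last exact: measurable_gauss_residual.
apply: measurableT_comp => //; apply: measurable_funM => //.
exact: measurable_residual.
Qed.

Lemma py_rintE g y : rint (fun x => (px x * gauss_pdf g (y - g *: x))%:E) =
  (\int[mu]_t (px (phi t) * gauss_pdf g (residual g y t))%:E)%E.
Proof.
rewrite rint_model// => [x|]; first by rewrite lee_fin mulr_ge0// gauss_pdf_ge0.
apply/measurable_EFinP/measurable_funM; first exact: measurable_density.
exact: measurable_gauss_residual.
Qed.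

Lemma pyE g y :
  py px g y = \int[mu]_t (px (phi t) * gauss_pdf g (residual g y t)).
Proof. by rewrite /py py_rintE. Qed.

Lemma integrable_gauss g y : 0 < g -> mu.-integrable [set: T]
  (EFin \o (fun t => px (phi t) * gauss_pdf g (residual g y t))).
Proof.
move=> g0; apply: (integrable_density_mul _ (gauss_cst d g)) => [|t].
  exact: measurable_gauss_residual.
by rewrite ger0_norm ?gauss_pdf_ge0// gauss_pdf_le_cst.
Qed.

(** The Gaussian factor is positive, so a zero integral would force [px] to vanish almost
    everywhere, against its total mass 1. *)
Lemma py_gt0 g y : 0 < g -> 0 < py px g y.
Proof.
move=> g0; rewrite pyE lt_neqAle Rintegral_ge0 ?andbT; last first.
  by move=> t _; rewrite mulr_ge0// gauss_pdf_ge0.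
have ig := integrable_gauss g y g0.
apply/eqP => /esym I0.
have k0 : {ae mu, forall t, setT t ->
    (px (phi t) * gauss_pdf g (residual g y t))%:E = 0%E}.
  apply: ge0_integral_eq0_ae => //.
  - by case/integrableP : ig.
  - by move=> t _; rewrite lee_fin mulr_ge0// gauss_pdf_ge0.
  - by rewrite -[LHS]fineK ?integrable_fin_num// -[fine _]/(Rintegral _ _ _) I0.
have : (\int[mu]_t (px (phi t))%:E = \int[mu]_t (cst 0 t))%E.
  apply: ge0_ae_eq_integral => //.
  - exact/measurable_EFinP/measurable_density.
  - by move=> t _; rewrite lee_fin.
  - apply: filterS k0 => t /(_ Logic.I)[] + _.
    move/eqP; rewrite mulf_eq0 (gt_eqF (gauss_pdf_gt0 _ _ g0)) orbF.
    by move=> /eqP ->.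
rewrite integral_density integral0 => /eqP.
by rewrite onee_eq0.
Qed.

(** The [i]-th partial derivative of [py px g], with the derivative moved onto the kernel under the
    integral. *)
Definition dpy g i y := \int[mu]_t (px (phi t) * dgauss g i (residual g y t)).

Lemma residual_line g y i h t :
  residual g (y + h *: delta_mx 0 i) t = residual g y t + h *: delta_mx 0 i.
Proof. by rewrite /residual addrAC. Qed.

Lemma is_derive_py_line g y i : 0 < g ->
  is_derive (0 : R) 1 (fun h : R => py px g (y + h *: delta_mx 0 i)) (dpy g i y).
Proof.
move=> g0.
pose f (h : R) t := px (phi t) * gauss_pdf g (residual g y t + h *: delta_mx 0 i).
have fE : (fun h : R => py px g (y + h *: delta_mx 0 i)) =
    (fun h => \int[mu]_t f h t).
  apply/funext => h; rewrite pyE; apply: eq_Rintegral => t _.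
  by rewrite residual_line.
have derf h t : is_derive h (1 : R) (f ^~ t)
    (px (phi t) * dgauss g i (residual g y t + h *: delta_mx 0 i)).
  exact: (is_deriveZ (px (phi t)) (is_derive_gauss_line g i (residual g y t) h g0)).
have d1f h t : partial1of2 f h t =
    px (phi t) * dgauss g i (residual g y t + h *: delta_mx 0 i).
  by rewrite partial1of2E; exact: derive_val.
pose G t := px (phi t) * dgauss_cst d g.
have C0 : 0 <= dgauss_cst d g.
  by rewrite /dgauss_cst divr_ge0// ?mulr_ge0 ?powR_ge0 ?ltW//; lra.
(* Differentiation under the integral asks for a neighbourhood of 0; the majorant [G] is valid for
   every [h], so the interval is arbitrary. *)
have I0 : `](-1)%R, 1%R[%classic (0 : R) by rewrite /= in_itv/=; apply/andP; split; lra.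
have intf h : `](-1)%R, 1%R[%classic h -> mu.-integrable [set: T] (EFin \o f h).
  move=> _; rewrite /f; under eq_fun do rewrite -residual_line.
  exact: integrable_gauss.
have derf1 h t : `](-1)%R, 1%R[%classic h -> [set: T] t -> derivable (f ^~ t) h 1.
  by move=> _ _; have [] := derf h t.
have G0 t : 0 <= G t by rewrite mulr_ge0.
have iG : mu.-integrable [set: T] (EFin \o G).
  by apply: (integrable_density_mul _ (dgauss_cst d g)) => // t; rewrite ger0_norm.
have Gub h t : `](-1)%R, 1%R[%classic h -> [set: T] t -> `|partial1of2 f h t| <= G t.
  move=> _ _; rewrite d1f normrM (ger0_norm (px_ge0 _)).
  by rewrite ler_wpM2l// dgauss_le.
rewrite fE; apply: DeriveDef.
  exact: (derivable_under_integral measurableT I0 intf derf1 G0 iG Gub).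
rewrite -derive1E (differentiation_under_integral measurableT I0 intf derf1 G0 iG Gub).
by apply: eq_Rintegral => t _; rewrite d1f scale0r addr0.
Qed.

(** Stated for a general bounded kernel [K] to serve both [py] and [dpy], the denominator and
    numerator of the score. *)
Lemma continuous_Rintegral_line (K : 'rV[R]_d -> R) (C : R) g y j :
  (forall y, measurable_fun [set: T] (fun t => K (residual g y t))) ->
  (forall z, `|K z| <= C) ->
  (forall z, continuous (fun s : R => K (z + s *: delta_mx 0 j))) ->
  continuous (fun s : R =>
    \int[mu]_t (px (phi t) * K (residual g (y + s *: delta_mx 0 j) t))).
Proof.
move=> mK KC cK s.
pose f (s : R) t := px (phi t) * K (residual g (y + s *: delta_mx 0 j) t).
have Is : s \in `](s - 1), (s + 1)[%classic.
  by rewrite inE/= in_itv/=; apply/andP; split; lra.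
have intf h : `](s - 1), (s + 1)[%classic h ->
    mu.-integrable [set: T] (EFin \o f h).
  by move=> _; apply: integrable_density_mul (mK _) (fun t => KC _).
have C0 : 0 <= C by exact: le_trans (KC 0).
have iG : mu.-integrable [set: T] (EFin \o (fun t => px (phi t) * C)).
  by apply: (integrable_density_mul _ C) => // t; rewrite ger0_norm.
apply: (continuity_under_integral measurableT intf _ iG _ Is).
  apply: aeW => t _ h _; apply: cvgM; first exact: cvg_cst.
  under eq_fun do rewrite residual_line.
  by rewrite residual_line; exact: cK.
move=> h _; apply: aeW => t _.
by rewrite normrM (ger0_norm (px_ge0 _)) ler_wpM2l.
Qed.

Lemma continuous_py_line g y j : 0 < g ->
  continuous (fun s : R => py px g (y + s *: delta_mx 0 j)).
Proof.
move=> g0; under eq_fun do rewrite pyE.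
apply: (continuous_Rintegral_line (gauss_pdf g) (gauss_cst d g)) => z.
- exact: measurable_gauss_residual.
- by rewrite ger0_norm ?gauss_pdf_ge0// gauss_pdf_le_cst.
- exact: continuous_gauss_line.
Qed.

Lemma continuous_dpy_line g i y j : 0 < g ->
  continuous (fun s : R => dpy g i (y + s *: delta_mx 0 j)).
Proof.
move=> g0; apply: (continuous_Rintegral_line (dgauss g i) (dgauss_cst d g)) => z.
- exact: measurable_dgauss_residual.
- exact: dgauss_le.
- exact: continuous_dgauss_line.
Qed.

End channel.

(** * The score *)

Section lines.
Context {R : realType} {d : nat}.
Implicit Types (f : 'rV[R]_d -> R) (y : 'rV[R]_d).

Lemma is_derive_line f y v (l : R) :
  is_derive (0 : R) 1 (fun h : R => f (y + h *: v)) l -> is_derive y v f l.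
Proof.
have E : (fun h : R => h^-1 *: (f (h *: v + y) - f y)) =
    (fun h : R => h^-1 *: (f (y + (h%:A + 0) *: v) - f (y + 0 *: v))).
  by apply/funext => h; rewrite addr0 scale0r addr0 [_%:A]mulr1 [h *: v + y]addrC.
move=> [df fl]; split; first by rewrite /derivable E; exact: df.
by rewrite -fl /derive E.
Qed.

Lemma derive0_line_cst f :
  (forall y i, is_derive (0 : R) 1 (fun h : R => f (y + h *: delta_mx 0 i)) 0) ->
  forall y z, f y = f z.
Proof.
move=> df.
have line y i (s : R) : f (y + s *: delta_mx 0 i) = f y.
  have d0 (h : R) : is_derive h (1 : R) (fun u : R => f (y + u *: delta_mx 0 i)) 0.
    (* The hypothesis gives derivatives at parameter 0 only: the line is restarted at parameter [h]
       and composed with [u - h]. *)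
    have dh : is_derive h (1 : R) (fun u : R => u - h) 1.
      by apply: is_derive_eq; rewrite subr0.
    have := df (y + h *: delta_mx 0 i) i; rewrite -{1}(subrr h) => d0.
    have := @is_derive1_comp _ _ (fun u : R => u - h) h _ _ d0 dh; rewrite mul0r.
    rewrite (_ : _ \o _ = fun u : R => f (y + u *: delta_mx 0 i))//.
    by apply/funext => u /=; rewrite -addrA -scalerDl [h + _]addrC subrK.
  by rewrite (is_derive_0_is_cst s 0 d0) scale0r addr0.
move=> y z.
(* The path from [y] to [z] changes one coordinate at a time; arbitrary lists of coordinates make
   the induction possible. *)
suff H (r : seq 'I_d) : f (y + \sum_(i <- r) (z 0 i - y 0 i) *: delta_mx 0 i) = f y.
  rewrite -(H (index_enum _)); congr f.
  under eq_bigr do rewrite scalerBl.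
  by rewrite sumrB -!row_sum_delta addrC subrK.
elim: r => [|i r IH]; first by rewrite big_nil addr0.
by rewrite big_cons addrCA addrC line.
Qed.

End lines.

Section score.
Context {R : realType} {d : nat} {disp} {T : measurableType disp}
  {mu : {sigma_finite_measure set T -> \bar R}} {phi : T -> 'rV[R]_d}
  (phi_model : is_model mu phi) {px : 'rV[R]_d -> R} (px_density : is_density px).
Implicit Types (g : R) (y z : 'rV[R]_d) (i j : 'I_d).

Local Notation dpy := (@dpy R d disp T mu phi px).
Local Notation residual := (@residual R d disp T phi).
Let py0 g y : 0 < g -> 0 < py px g y.
Proof. exact: (py_gt0 phi_model px_density). Qed.

Lemma is_derive_ln_py_line g y i : 0 < g ->
  is_derive (0 : R) 1 (fun h : R => ln (py px g (y + h *: delta_mx 0 i)))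
    (dpy g i y / py px g y).
Proof.
move=> g0; have dp := is_derive_py_line phi_model px_density g y i g0.
have dl : is_derive (py px g (y + 0 *: delta_mx 0 i)) 1 (@ln R) (py px g y)^-1.
  by rewrite scale0r addr0; exact/is_derive1_ln/py0.
have := is_derive1_comp dl dp.
by rewrite mulrC.
Qed.

Lemma scoreE g y i : 0 < g -> score px g y 0 i = dpy g i y / py px g y.
Proof.
move=> g0; rewrite mxE.
by have [_ ->] := is_derive_line (fun z => ln (py px g z)) _ _ _
  (is_derive_ln_py_line g y i g0).
Qed.

Lemma is_derive_score_line g y i : 0 < g ->
  is_derive (0 : R) 1 (fun h : R => ln (py px g (y + h *: delta_mx 0 i)))
    (score px g y 0 i).
Proof. by move=> g0; rewrite scoreE//; exact: is_derive_ln_py_line. Qed.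

Lemma continuous_score_line g y i j : 0 < g ->
  continuous (fun s : R => score px g (y + s *: delta_mx 0 j) 0 i).
Proof.
move=> g0; under eq_fun do rewrite scoreE//.
move=> s; apply: cvgM.
  exact: (continuous_dpy_line phi_model px_density).
apply: cvgV; first by rewrite gt_eqF// py0.
exact: (continuous_py_line phi_model px_density).
Qed.

(** Measurability is joint in [g] and the position because [g] is itself integrated; [py] is then a
    partial integral in the sense of Tonelli. *)
Lemma measurable_py {disp'} {S : measurableType disp'} (g : S -> R)
    (Y : S -> 'rV[R]_d) : measurable_fun [set: S] g -> measurable_coords Y ->
  measurable_fun [set: S] (fun s => py px (g s) (Y s)).
Proof.
move=> mg mY.
pose H (p : S * T) := (px (phi p.2) * gauss_pdf (g p.1) (Y p.1 - g p.1 *: phi p.2))%:E.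
have mphi : measurable_coords phi by case: phi_model.
have H0 p : (0 <= H p)%E.
  by rewrite lee_fin mulr_ge0 ?gauss_pdf_ge0//; case: px_density.
have mg1 : measurable_fun [set: (S * T)%type] (fun p => g p.1).
  exact: measurableT_comp mg measurable_fst.
have mH : measurable_fun [set: (S * T)%type] H.
  apply/measurable_EFinP; apply: measurable_funM.
    apply: (measurable_density px_density) => i.
    exact: measurableT_comp (mphi i) measurable_snd.
  apply: measurable_gauss_pdf => // i.
  under eq_fun do rewrite !mxE.
  apply: measurable_funB; first exact: measurableT_comp (mY i) measurable_fst.
  apply: measurable_funM => //.
  exact: measurableT_comp (mphi i) measurable_snd.
have mF := measurable_fun_fubini_tonelli_F (m2 := mu) H mH H0.
rewrite (_ : (fun s => _) = fine \o fubini_F mu H).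
  exact: measurableT_comp (fine_measurable measurableT) mF.
by apply/funext => s; rewrite /py (py_rintE phi_model px_density).
Qed.

Lemma measurable_score {disp'} {S : measurableType disp'} (g : S -> R)
    (Y : S -> 'rV[R]_d) (D : set S) i : measurable D ->
  (forall s, D s -> 0 < g s) ->
  measurable_fun [set: S] g -> measurable_coords Y ->
  measurable_fun D (fun s => score px (g s) (Y s) 0 i).
Proof.
move=> mD g0 mg mY.
(* the score is a pointwise limit of difference quotients *)
pose q n s := n.+1%:R * (ln (py px (g s) (Y s + n.+1%:R^-1 *: delta_mx 0 i)) -
                         ln (py px (g s) (Y s))).
apply: (measurable_fun_cvg (h := q)) => [n|s Ds].
  apply: (measurable_funS measurableT) => //; apply: measurable_funM => //.
  apply: measurable_funB; apply: (measurableT_comp (@measurable_ln R)).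
    apply: measurable_py => // j; under eq_fun do rewrite !mxE.
    by apply: measurable_funD.
  exact: measurable_py.
have [dl sE] := is_derive_score_line (g s) (Y s) i (g0 s Ds).
have /cvgr_dnbhsP/(_ (fun n => n.+1%:R^-1)) H := dl.
rewrite -sE; apply: cvg_trans; last apply: H.
  apply: near_eq_cvg; apply: nearW => n /=.
  by rewrite /q addr0 scale0r addr0 invrK [_%:A]mulr1.
split; last exact: cvg_harmonic.
by move=> n; rewrite gt_eqF// invr_gt0.
Qed.

Lemma py_vanishes g (v : 'rV[R]_d) : 0 < g -> v != 0 ->
  py px g (n%:R *: v) @[n --> \oo] --> (0 : R).
Proof.
move=> g0 v0.
have [j vj0] : exists j, v 0 j != 0.
  apply: contrapT => nv; move/eqP: v0; apply; apply/rowP => j; rewrite mxE.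
  by apply/eqP/negPn/negP => vj; apply: nv; exists j.
pose f n t := (px (phi t) * gauss_pdf g (residual g (n%:R *: v) t))%:E.
have C0 := gauss_cst_gt0 (d := d) g g0.
have px0 x : 0 <= px x by case: px_density.
have gauss0 t : gauss_pdf g (residual g (n%:R *: v) t) @[n --> \oo] --> (0 : R).
  set b := g * phi t 0 j.
  (* The denominator of [gauss_pdf_le] at coordinate [j] of the residual. *)
  pose w n : R := 1 + (n%:R * v 0 j - b) ^+ 2 / (2 * g).
  have w_gt0 n : 0 < w n by rewrite ltr_pwDl// divr_ge0 ?sqr_ge0// mulr_ge0// ltW.
  have w_oo : w n @[n --> \oo] --> +oo.
    apply/cvgryPge => A; near=> n.
    have a0 : 0 < `|v 0 j| by rewrite normr_gt0.
    (* With [x] the absolute value of [n%:R * v 0 j - b], the bound [2 * x - 1 <= x ^+ 2] reduces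
       the claim to a linear condition on [n], which is this threshold. *)
    have nK : (2 * g * A + 2 * `|b| + 1) / (2 * `|v 0 j|) <= n%:R.
      by near: n; exact: nbhs_infty_ger.
    have {}nK : 2 * g * A + 2 * `|b| + 1 <= n%:R * (2 * `|v 0 j|).
      by rewrite -ler_pdivrMr// mulr_gt0.
    rewrite /w -lerBlDl ler_pdivlMr ?mulr_gt0//.
    have : n%:R * `|v 0 j| - `|b| <= `|n%:R * v 0 j - b|.
      by rewrite -[X in X * _](normr_nat R) -normrM lerB_dist.
    have := sqr_ge0 (`|n%:R * v 0 j - b| - 1).
    rewrite sqrrB1 real_normK ?num_real//; lra.
  have winv : (w n)^-1 @[n --> \oo] --> (0 : R).
    by apply/gtr0_cvgV0 => //; exact: nearW.
  have Cw : gauss_cst d g * (w n)^-1 @[n --> \oo] --> (0 : R).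
    by rewrite -(mulr0 (gauss_cst d g)); apply: cvgM => //; exact: cvg_cst.
  apply: (@squeeze_cvgr _ _ _ _ (fun=> 0) _ _ _ _ _ Cw); last exact: cvg_cst.
  apply: nearW => n; rewrite gauss_pdf_ge0/=.
  by rewrite (le_trans (gauss_pdf_le _ _ j g0))// !mxE.
have ig : mu.-integrable [set: T] (EFin \o (fun t => px (phi t) * gauss_cst d g)).
  apply: (integrable_density_mul phi_model px_density _ (gauss_cst d g)) => //.
  by move=> t; rewrite gtr0_norm.
have f_lim : (\int[mu]_t f n t)%E @[n --> \oo] --> (\int[mu]_t (cst 0 t))%E.
  apply: (dominated_cvg measurableT _ _ _ ig) => //.
  - move=> n; have := integrable_gauss phi_model px_density g (n%:R *: v) g0.
    by case/integrableP.
  - move=> t _; apply: cvg_EFin; first exact: nearW.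
    by rewrite -(mulr0 (px (phi t))); apply: cvgM; [exact: cvg_cst|exact: gauss0].
  - move=> n t _; rewrite lee_fin normrM ger0_norm// ler_wpM2l//.
    by rewrite ger0_norm ?gauss_pdf_ge0// gauss_pdf_le_cst.
move: f_lim; rewrite integral0 => /fine_cvgP[_].
apply: cvg_trans; apply: near_eq_cvg; apply: nearW => n /=.
by rewrite (pyE phi_model px_density).
Unshelve. all: by end_near. Qed.

Lemma py_shift_le_eq0 g (v : 'rV[R]_d) : 0 < g ->
  (forall y, py px g y <= py px g (y + v)) -> v = 0.
Proof.
move=> g0 pv; apply/eqP/negPn/negP => v0.
have p0n n : py px g 0 <= py px g (n%:R *: v).
  elim: n => [|n IH]; first by rewrite scale0r.
  by rewrite (le_trans IH)// -natr1 scalerDl scale1r.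
have f_lim := py_vanishes _ _ g0 v0.
have := limr_ge (cvgP _ f_lim) (nearW _ p0n).
by rewrite (cvg_lim _ f_lim)// => p0; have := py0 g 0 g0; rewrite ltNge p0.
Qed.

End score.

(** * The information-estimation metric *)

Section iem.
Context {R : realType} {d : nat} {disp} {T : measurableType disp}
  {mu : {sigma_finite_measure set T -> \bar R}} {phi : T -> 'rV[R]_d}
  (phi_model : is_model mu phi) {px : 'rV[R]_d -> R} (px_density : is_density px).
Implicit Types (g G : R) (x y w : 'rV[R]_d) (i j : 'I_d).

Definition score_gap g x1 x2 w : 'rV[R]_d :=
  score px g (g *: x1 + w) - score px g (g *: x2 + w).

Lemma score_gapE g x1 x2 w i : score_gap g x1 x2 w 0 i =
  score px g (g *: x1 + w) 0 i - score px g (g *: x2 + w) 0 i.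
Proof. by rewrite /score_gap mxE [X in _ + X]mxE. Qed.

Definition iem_density g x1 x2 w : R := gauss_pdf g w * sqnorm (score_gap g x1 x2 w).

Lemma iem_density_ge0 g x1 x2 w : 0 <= iem_density g x1 x2 w.
Proof. by rewrite mulr_ge0 ?gauss_pdf_ge0 ?sqnorm_ge0. Qed.

Let measurable_phi : measurable_coords phi.
Proof. by case: phi_model. Qed.

Lemma measurable_iem_density {disp'} {S : measurableType disp'} (g : S -> R)
    (W : S -> 'rV[R]_d) (D : set S) x1 x2 : measurable D ->
  (forall s, D s -> 0 < g s) -> measurable_fun [set: S] g -> measurable_coords W ->
  measurable_fun D (fun s => iem_density (g s) x1 x2 (W s)).
Proof.
move=> mD g0 mg mW; apply: measurable_funM.
  by apply: (measurable_funS measurableT) => //; exact: measurable_gauss_pdf.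
apply: measurable_sum => i; apply: measurable_funX.
under eq_fun do rewrite score_gapE.
have mline x : measurable_coords (fun s => g s *: x + W s).
  move=> k; under eq_fun do rewrite !mxE.
  by apply: measurable_funD => //; exact: measurable_funM.
by apply: measurable_funB; apply: (measurable_score phi_model px_density).
Qed.

Lemma iem_integrandE g x1 x2 : 0 < g ->
  iem_integrand px x1 x2 g = (\int[mu]_t (iem_density g x1 x2 (phi t))%:E)%E.
Proof.
move=> g0; have [H _ _] := phi_model.
rewrite /iem_integrand H//; first by move=> w; rewrite lee_fin iem_density_ge0.
by apply/measurable_EFinP; apply: measurable_iem_density.
Qed.

Lemma iem_integrand_ge0 g x1 x2 : 0 < g -> (0 <= iem_integrand px x1 x2 g)%E.
Proof.
move=> g0; rewrite iem_integrandE// integral_ge0// => t _.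
by rewrite lee_fin iem_density_ge0.
Qed.

(** Measurability of the scores is available for [0 < g], so the density is extended by zero outside
    [D] before Tonelli is applied on the whole product. *)
Lemma measurable_iem_integrand G x1 x2 :
  measurable_fun `]0, G]%classic (iem_integrand px x1 x2).
Proof.
pose D : set (measurableTypeR R * T) := [set s | 0 < s.1].
have mD : measurable D.
  have := @measurable_fst _ _ (measurableTypeR R) T measurableT _
    (measurable_itv `]0, +oo[).
  rewrite setTI; congr measurable; apply/seteqP.
  by split => s /=; rewrite in_itv/= andbT.
pose f (s : measurableTypeR R * T) := (iem_density s.1 x1 x2 (phi s.2))%:E.
have mf : measurable_fun [set: (measurableTypeR R * T)%type] (f \_ D).
  apply: (measurable_restrictT f mD).1; apply/measurable_EFinP.
  apply: measurable_iem_density => // i.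
  exact: measurableT_comp (measurable_phi i) measurable_snd.
have f0 s : (0 <= (f \_ D) s)%E.
  by rewrite patchE; case: ifP => // _; rewrite lee_fin iem_density_ge0.
have mF := measurable_fun_fubini_tonelli_F (m2 := mu) _ mf f0.
apply: (eq_measurable_fun (fubini_F mu (f \_ D))).
  move=> g; rewrite inE/= in_itv/= => /andP[g0 _]; rewrite iem_integrandE//.
  by apply: eq_integral => t _; rewrite patchE mem_set.
exact: (measurable_funS measurableT).
Qed.

(** The integrand is continuous on coordinate lines, so the third clause of [is_model] makes it
    vanish everywhere; its Gaussian factor is positive, which leaves the squared gap. *)
Lemma iem_integrand_eq0 g x1 x2 : 0 < g -> iem_integrand px x1 x2 g = 0%E ->
  forall w i, score px g (g *: x1 + w) 0 i = score px g (g *: x2 + w) 0 i.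
Proof.
move=> g0; rewrite (iem_integrandE _ _ _ g0) => I0 w i; have [_ _ H] := phi_model.
have : iem_density g x1 x2 w = 0.
  apply: H => //.
  - by move=> x; exact: iem_density_ge0.
  - move=> x j s; apply: cvgM; first exact: continuous_gauss_line.
    apply: cvg_big => [|k _]; first exact: add_continuous.
    have cs a : (score px g (g *: a + (x + u *: delta_mx 0 j))) 0 k @[u --> s] -->
        (score px g (g *: a + (x + s *: delta_mx 0 j))) 0 k.
      under eq_fun do rewrite addrA.
      by rewrite addrA; exact: (continuous_score_line phi_model px_density).
    under eq_fun do rewrite score_gapE expr2.
    rewrite score_gapE expr2.
    by apply: cvgM; apply: cvgB; exact: cs.
  - exact: measurable_iem_density.
move/eqP; rewrite mulf_eq0 (gt_eqF (gauss_pdf_gt0 _ _ g0))/= => /eqP n0.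
have := sqr_coord_le_sqnorm (score_gap g x1 x2 w) i.
rewrite n0 => sq0; have /eqP : score_gap g x1 x2 w 0 i ^+ 2 == 0.
  by rewrite eq_le sq0 sqr_ge0.
by move/eqP; rewrite sqrf_eq0 score_gapE subr_eq0 => /eqP.
Qed.

(* Equal scores along two shifted copies force [py px g] to be multiplied by a
   constant under the shift [g *: (x1 - x2)]; iterating the shift in the
   direction in which [py] does not decrease contradicts [py_vanishes]. *)
Lemma score_shift_inj g x1 x2 : 0 < g ->
  (forall w i, score px g (g *: x1 + w) 0 i = score px g (g *: x2 + w) 0 i) ->
  x1 = x2.
Proof.
move=> g0 eq_score; pose v := g *: (x1 - x2).
pose h w := ln (py px g (g *: x1 + w)) - ln (py px g (g *: x2 + w)).
have hcst : forall y z, h y = h z.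
  apply: derive0_line_cst => y i.
  have dx x := is_derive_score_line phi_model px_density g (g *: x + y) i g0.
  have e0 : score px g (g *: x1 + y) 0 i - score px g (g *: x2 + y) 0 i = 0.
    by apply/eqP; rewrite subr_eq0; apply/eqP; exact: eq_score.
  have hE : (fun s : R => h (y + s *: delta_mx 0 i)) =
      (fun s => ln (py px g (g *: x1 + y + s *: delta_mx 0 i))) -
      (fun s => ln (py px g (g *: x2 + y + s *: delta_mx 0 i))).
    by apply/funext => s; rewrite /h (addrA (g *: x1)) (addrA (g *: x2)).
  rewrite hE; exact: is_derive_eq (is_deriveB (dx x1) (dx x2)) e0.
have pyg_gt0 y := py_gt0 phi_model px_density g y g0.
(* Evaluating the constant function [h] at [y - g *: x2] places the two arguments at [y + v] and
   [y]. *)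
have shift y : ln (py px g (y + v)) = ln (py px g y) + h 0.
  have e2 : g *: x2 + (y - g *: x2) = y by rewrite addrC subrK.
  have e1 : g *: x1 + (y - g *: x2) = y + v by rewrite /v scalerBr addrCA.
  by rewrite (hcst 0 (y - g *: x2)) /h e1 e2 [RHS]addrC subrK.
have v0 : v = 0.
  have [h0|h0] := leP 0 (h 0).
    apply: (py_shift_le_eq0 phi_model px_density g) => // y.
    by rewrite -ler_ln ?posrE// shift lerDl.
  apply/eqP; rewrite -oppr_eq0; apply/eqP.
  apply: (py_shift_le_eq0 phi_model px_density g) => // y.
  rewrite -ler_ln ?posrE// -{1}(subrK v y) shift gerDl; exact: ltW.
by move/eqP: v0; rewrite scaler_eq0 gt_eqF//= subr_eq0 => /eqP.
Qed.

Lemma iem_sq_ge0 x1 x2 G : (0 <= iem_sq px x1 x2 G)%E.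
Proof.
apply: integral_ge0 => g /=; rewrite in_itv/= => /andP[g0 _].
exact: iem_integrand_ge0.
Qed.

Lemma iem_sq_eq0 x1 x2 G : 0 < G -> iem_sq px x1 x2 G = 0%E -> x1 = x2.
Proof.
move=> G0 I0.
have ae0 : {ae @lebesgue_measure R, forall g, `]0, G]%classic g ->
    iem_integrand px x1 x2 g = 0%E}.
  apply: ge0_integral_eq0_ae I0 => //; first exact: measurable_iem_integrand.
  by move=> g /=; rewrite in_itv/= => /andP[g0 _]; exact: iem_integrand_ge0.
have [g /andP[g0 gG] Hg] := ae_in_itv _ _ _ ae0 G0.
apply: (score_shift_inj g _ _ g0); apply: (iem_integrand_eq0 _ _ _ g0).
by apply: Hg; rewrite /= in_itv/= g0 ltW.
Qed.

Lemma iem_sqxx x G : iem_sq px x x G = 0%E.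
Proof.
apply: integral0_eq => g /=; rewrite in_itv/= => /andP[g0 _].
rewrite iem_integrandE//; apply: integral0_eq => t _.
rewrite /iem_density /score_gap subrr /sqnorm big1 ?mulr0// => i _.
by rewrite mxE expr0n.
Qed.

Lemma sqnormBC (u v : 'rV[R]_d) : sqnorm (u - v) = sqnorm (v - u).
Proof. by apply: eq_bigr => i _; rewrite -opprB mxE sqrrN. Qed.

Lemma iem_sqC x1 x2 G : iem_sq px x1 x2 G = iem_sq px x2 x1 G.
Proof.
apply: eq_integral => g _; apply: (congr1 (@rint R d)); apply: funext => w.
by apply: (congr1 (fun r => (gauss_pdf g w * r)%:E)); exact: sqnormBC.
Qed.

(** Young's inequality with weight [a]: in each coordinate the difference of the two sides is
    [a^-1 * (a * p - q) ^+ 2]. *)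
Lemma sqnormD_le (a : R) (u v : 'rV[R]_d) : 0 < a ->
  sqnorm (u + v) <= (1 + a) * sqnorm u + (1 + a^-1) * sqnorm v.
Proof.
move=> a0; rewrite !mulr_sumr -big_split/=; apply: ler_sum => i _; rewrite mxE.
set p := u 0 i; set q := v 0 i.
rewrite -subr_ge0 (_ : _ - _ = a^-1 * (a * p - q) ^+ 2).
  by rewrite mulr_ge0 ?sqr_ge0// invr_ge0 ltW.
by field; rewrite gt_eqF.
Qed.

Lemma iem_sq_triangle (a : R) x1 x2 x3 G : 0 < a ->
  (iem_sq px x1 x3 G <=
   (1 + a)%:E * iem_sq px x1 x2 G + (1 + a^-1)%:E * iem_sq px x2 x3 G)%E.
Proof.
move=> a0.
have b0 : 0 <= 1 + a by rewrite addr_ge0// ltW.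
have c0 : 0 <= 1 + a^-1 by rewrite addr_ge0// invr_ge0 ltW.
have I0 y z g : `]0, G]%classic g -> (0 <= iem_integrand px y z g)%E.
  by move=> /=; rewrite in_itv/= => /andP[g0 _]; exact: iem_integrand_ge0.
have mI y z := measurable_iem_integrand G y z.
have mZ (k : R) y z : measurable_fun `]0, G]%classic
  (fun g => k%:E * iem_integrand px y z g)%E by exact: measurable_funeM.
have Z0 (k : R) y z g : 0 <= k -> `]0, G]%classic g ->
    (0 <= k%:E * iem_integrand px y z g)%E.
  by move=> k0 Dg; rewrite mule_ge0 ?I0.
have ZE (k : R) y z : 0 <= k -> (k%:E * iem_sq px y z G =
    \int[@lebesgue_measure R]_(g in `]0%R, G]) (k%:E * iem_integrand px y z g))%E.
  move=> k0; apply/esym.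
  by apply: ge0_integralZl_EFin => //; [exact: I0|exact: mI].
rewrite (ZE _ _ _ b0) (ZE _ _ _ c0) -ge0_integralD; [|exact: measurable_itv|
  by move=> g; exact: Z0|exact: mZ|by move=> g; exact: Z0|exact: mZ].
apply: ge0_le_integral; [exact: measurable_itv|exact: I0|exact: mI|
  by apply: emeasurable_funD; exact: mZ|].
move=> g /=; rewrite in_itv/= => /andP[g0 _].
have mE y z : measurable_fun [set: T] (fun t => (iem_density g y z (phi t))%:E).
  by apply/measurable_EFinP; apply: measurable_iem_density.
have mEZ (k : R) y z :
    measurable_fun [set: T] (fun t => k%:E * (iem_density g y z (phi t))%:E)%E.
  exact: measurable_funeM.
have E0 y z t : (0 <= (iem_density g y z (phi t))%:E)%E.
  by rewrite lee_fin iem_density_ge0.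
have EZ (k : R) y z : 0 <= k -> (k%:E * iem_integrand px y z g =
    \int[mu]_t (k%:E * (iem_density g y z (phi t))%:E))%E.
  by move=> k0; rewrite (iem_integrandE _ _ _ g0); apply/esym/ge0_integralZl_EFin.
rewrite (EZ _ _ _ b0) (EZ _ _ _ c0) (iem_integrandE _ _ _ g0).
rewrite -ge0_integralD; [|exact: measurableT|
  by move=> t _; rewrite mule_ge0|exact: mEZ|
  by move=> t _; rewrite mule_ge0|exact: mEZ].
apply: ge0_le_integral; [exact: measurableT|by move=> t _; exact: E0|exact: mE|
  by apply: emeasurable_funD; exact: mEZ|].
move=> t _; rewrite -!EFinM -EFinD lee_fin /iem_density.
rewrite mulrCA [X in _ <= _ + X]mulrCA -mulrDr ler_wpM2l ?gauss_pdf_ge0//.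
rewrite (_ : score_gap g x1 x3 _ =
  score_gap g x1 x2 (phi t) + score_gap g x2 x3 (phi t)) ?sqnormD_le//.
by rewrite /score_gap addrA subrK.
Qed.

End iem.

(* The optimal weight is [a = sqrt I23 / sqrt I12]. *)
Lemma sqrt_triangle {R : rcfType} (I13 I12 I23 : R) : 0 < I12 -> 0 < I23 ->
  (forall a : R, 0 < a -> I13 <= (1 + a) * I12 + (1 + a^-1) * I23) ->
  Num.sqrt I13 <= Num.sqrt I12 + Num.sqrt I23.
Proof.
move=> I12_gt0 I23_gt0 I13_le.
rewrite -(ger0_norm (addr_ge0 (sqrtr_ge0 I12) (sqrtr_ge0 I23))) -sqrtr_sqr.
apply: ler_wsqrtr.
set p := Num.sqrt I12; set q := Num.sqrt I23.
have p0 : 0 < p by rewrite sqrtr_gt0.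
have q0 : 0 < q by rewrite sqrtr_gt0.
have pE : I12 = p ^+ 2 by rewrite sqr_sqrtr// ltW.
have qE : I23 = q ^+ 2 by rewrite sqr_sqrtr// ltW.
have := I13_le (q / p) (divr_gt0 q0 p0); rewrite [X in _ * X + _]pE [X in _ + _ * X]qE.
suff -> : (1 + q / p) * p ^+ 2 + (1 + (q / p)^-1) * q ^+ 2 = (p + q) ^+ 2 by [].
by field; rewrite !gt_eqF.
Qed.

Lemma sqrt_fine_triangle {R : realType} (I13 I12 I23 : \bar R) :
  I13 \is a fin_num -> I12 \is a fin_num -> I23 \is a fin_num ->
  0 < fine I12 -> 0 < fine I23 ->
  (forall a : R, 0 < a ->
    (I13 <= (1 + a)%:E * I12 + (1 + a^-1)%:E * I23)%E) ->
  Num.sqrt (fine I13) <= Num.sqrt (fine I12) + Num.sqrt (fine I23).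
Proof.
case: I13 I12 I23 => [r13||] [r12||] [r23||]// _ _ _ r12_gt0 r23_gt0 le13.
by apply: sqrt_triangle => // a a0; rewrite -lee_fin EFinD !EFinM; exact: le13.
Qed.

Theorem theorem1 (R : realType) (d : nat) (px : 'rV[R]_d -> R) (G : R) :
  is_density px ->
  (forall x1 x2 : 'rV[R]_d, (iem_sq px x1 x2 G < +oo)%E) ->
  0 < G ->
  forall x1 x2 x3 : 'rV[R]_d,
    [/\ IEM px x1 x2 G = IEM px x2 x1 G,
        0 <= IEM px x1 x2 G,
        (IEM px x1 x2 G = 0 <-> x1 = x2) &
        IEM px x1 x3 G <= IEM px x1 x2 G + IEM px x2 x3 G].
Proof.
move=> px_density fin G0 x1 x2 x3.
have [disp [T [mu [phi phi_model]]]] := @model_exists R d.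
have I_ge0 := iem_sq_ge0 phi_model px_density.
have I_fin x y : iem_sq px x y G \is a fin_num by rewrite ge0_fin_numE.
have IEMxx x : IEM px x x G = 0.
  by rewrite /IEM (iem_sqxx phi_model px_density) sqrtr0.
have I_gt0 x y : x != y -> 0 < fine (iem_sq px x y G).
  move=> /eqP xy; apply: fine_gt0; rewrite fin lt_neqAle I_ge0 !andbT.
  apply/eqP => /esym I0; apply: xy.
  exact: (iem_sq_eq0 phi_model px_density x y G G0 I0).
split.
- by rewrite /IEM iem_sqC.
- exact: sqrtr_ge0.
- split=> [I0|->]; last exact: IEMxx.
  apply/eqP/negPn/negP => /I_gt0 I_pos.
  by move: I0 => /eqP; rewrite gt_eqF// /IEM sqrtr_gt0.
(* Coinciding points are treated apart; otherwise both integrals on the right are positive and the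
   optimal weight is defined. *)
- have [->|x12] := eqVneq x1 x2; first by rewrite IEMxx add0r.
  have [->|x23] := eqVneq x2 x3; first by rewrite IEMxx addr0.
  apply: (sqrt_fine_triangle _ _ _ (I_fin _ _) (I_fin _ _) (I_fin _ _)
    (I_gt0 _ _ x12) (I_gt0 _ _ x23)) => a a0.
  exact: (iem_sq_triangle phi_model px_density).
Qed.
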